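(* The knots $\mathbf{9_{32}}$ and $\mathbf{9_{33}}$ have ascending number $2$, that is, $a(\mathbf{9_{32}}) = a(\mathbf{9_{33}}) = 2$. The knot $\mathbf{9_{40}}$ has ascending number at most $3$, that is, $a(\mathbf{9_{40}}) \leq 3$.
   Context: Knot names are those of the standard Rolfsen knot table. Roller-coaster algorithm: given a knot diagram, a starting point on it (away from the crossings) and an orientation, traverse the diagram once from the starting point in the direction of the orientation, and change every crossing that is first encountered along the strand passing below (under) the crossing. Crossings first encountered along the over-strand are left unchanged. The resulting diagram (an ascending diagram) is a diagram of the unknot. The ascending number $a(K)$ of a knot $K$ is the minimal number of crossings changed by the roller-coaster algorithm, over all diagrams of $K$ and all choices of starting point and orientation. *)

(* Defs.v *)
From mathcomp Require Import all_boot.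
From mathcomp Require Import boolp.
From Stdlib Require Import Relations.

Set Implicit Arguments.
Unset Strict Implicit.
Unset Printing Implicit Defensive.

(* Knot diagrams are encoded by signed Gauss codes: walk once along the       *)
(* diagram, from a base point (away from the crossings) and in a chosen       *)
(* direction, and record every passage through a crossing as a letter         *)
(*   (name of the crossing, do we pass over?, is the crossing positive?).     *)
(* So a code is a diagram together with a base point and an orientation; the  *)
(* other base points and the other orientation of the same diagram are given  *)
(* by the rotations of the code and of its reverse. A crossing is positive    *)
(* if its under-strand runs from right to left as seen from the over-strand;  *)
(* this does not depend on the orientation of the knot.                       *)
Definition letter : Type := (nat * bool * bool)%type.
Definition crossing (l : letter) : nat := l.1.1.
Definition over (l : letter) : bool := l.1.2.
Definition positive (l : letter) : bool := l.2.

(* The other passage through the same crossing. *)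
Definition opp (l : letter) : letter := (crossing l, ~~ over l, positive l).

Definition gauss_code (w : seq letter) : bool :=
  uniq [seq (crossing l, over l) | l <- w] && all (fun l => opp l \in w) w.

(* The underlying 4-valent graph has one edge from l to next w l for every    *)
(* letter l of w. The dart (l, true) is this edge traversed from l to         *)
(* next w l, and (l, false) is the same edge traversed backwards.             *)
Definition dart : Type := (letter * bool)%type.
Definition darts (w : seq letter) : seq dart :=
  [seq (l, d) | l <- w, d <- [:: true; false]].

(* Follow a dart to its end and turn left there. Arriving forwards at m, the  *)
(* other strand crosses from right to left iff m is an over-passage of a      *)
(* positive crossing or an under-passage of a negative one; in that case      *)
(* turning left means following the other strand forwards.                    *)
Definition turn (w : seq letter) (e : dart) : dart :=
  let m := if e.2 then next w e.1 else e.1 in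
  if (over m == positive m) == e.2 then (opp m, true)
  else (prev w (opp m), false).

(* The faces are the orbits of turn, each listed in the order of darts w. *)
Definition face (w : seq letter) (e : dart) : seq dart :=
  [seq e' <- darts w | e' \in traject (turn w) e (size (darts w))].
Definition faces (w : seq letter) : seq (seq dart) :=
  undup [seq face w e | e <- darts w].

(* V + F = E + 2: the surface obtained by gluing a disk to each face is a     *)
(* sphere. The empty code is the diagram without crossings.                   *)
Definition planar (w : seq letter) : bool :=
  nilp w || ((size w)./2 + size (faces w) == size w + 2).

Record diagram : Type := Diagram {
  code : seq letter;
  _ : gauss_code code && planar code
}.

(* The edges leaving x, y, z are the three sides of a triangular face. *)
Definition triangle (w : seq letter) (x y z : letter) : bool :=
  has (fun d => (iter 3 (turn w) (x, d) == (x, d)) &&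
         perm_eq (unzip1 (traject (turn w) (x, d) 3)) [:: x; y; z])
      [:: true; false].

(* Changes of name, base point and orientation, and the Reidemeister moves.   *)
(* In R2, opposite signs mean that the two strands bound a bigon. In R3, a    *)
(* side that passes over at both ends is the top strand of the triangle; such *)
(* a side exists iff the three strands are not cyclically layered.            *)
Inductive move : seq letter -> seq letter -> Prop :=
| Rename (f : nat -> nat) w of injective f :
    move w [seq (f (crossing l), over l, positive l) | l <- w]
| Base_point k w : move w (rot k w)
| Orientation w : move w (rev w)
| R1 x u : move (x :: opp x :: u) u
| R2_parallel x y u v of over x = over y & positive x != positive y :
    move ([:: x; y] ++ u ++ [:: opp x; opp y] ++ v) (u ++ v)
| R2_antiparallel x y u v of over x = over y & positive x != positive y :
    move ([:: x; y] ++ u ++ [:: opp y; opp x] ++ v) (u ++ v)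
| R3 x x' y y' z z' t u v
    of triangle ([:: x; x'] ++ t ++ [:: y; y'] ++ u ++ [:: z; z'] ++ v) x y z
     & [|| over x && over x', over y && over y' | over z && over z'] :
    move ([:: x; x'] ++ t ++ [:: y; y'] ++ u ++ [:: z; z'] ++ v)
         ([:: x'; x] ++ t ++ [:: y'; y] ++ u ++ [:: z'; z] ++ v).

(* Diagrams of the same (unoriented) knot; every intermediate code of a chain *)
(* of moves has to be that of a planar diagram as well.                       *)
Definition same_knot : diagram -> diagram -> Prop :=
  clos_refl_sym_trans diagram (fun D D' => move (code D) (code D')).

(* The crossings first encountered along the under-strand. *)
Definition roller_coaster_changes (w : seq letter) : seq nat :=
  [seq crossing l | l <- w & ~~ over l && (index l w < index (opp l) w)].

(* The minimum also ranges over base points and orientations, as they are     *)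
(* part of the code.                                                          *)
Definition achieved (K : diagram) (n : nat) : Prop :=
  exists2 D, same_knot K D & size (roller_coaster_changes (code D)) = n.

Lemma achieved_ex (K : diagram) : exists n, `[< achieved K n >].
Proof.
exists (size (roller_coaster_changes (code K))).
by apply/asboolP; exists K => //; apply: rst_refl.
Qed.

Definition ascending_number (K : diagram) : nat := ex_minn (achieved_ex K).

(* The code that visits the crossings in the order g, alternately passing     *)
(* over and under, with the positive crossings listed in pos.                 *)
Definition alternating_code (g pos : seq nat) : seq letter :=
  [seq (p.2, ~~ odd p.1, p.2 \in pos) | p <- zip (iota 0 (size g)) g].

(* Reduced alternating diagrams of three knots of the Rolfsen table, which    *)
(* does not distinguish mirror images (nor does the ascending number: taking  *)
(* the mirror image and reversing the orientation preserves the changes).     *)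
(* Among the prime alternating knots with nine crossings each of them is      *)
(* determined by its Alexander polynomial, respectively                       *)
(*   1 - 6t + 14t^2 - 17t^3 + 14t^4 - 6t^5 + t^6,                             *)
(*   1 - 6t + 14t^2 - 19t^3 + 14t^4 - 6t^5 + t^6,                             *)
(*   1 - 7t + 18t^2 - 23t^3 + 18t^4 - 7t^5 + t^6.                             *)
Definition code_9_32 : seq letter := alternating_code
  [:: 1; 2; 3; 1; 4; 5; 6; 3; 2; 7; 8; 4; 9; 6; 7; 8; 5; 9] [:: 1; 4; 9].
Definition code_9_33 : seq letter := alternating_code
  [:: 1; 2; 3; 1; 4; 5; 6; 3; 2; 7; 8; 6; 9; 4; 7; 8; 5; 9] [:: 1; 6; 7; 8].
Definition code_9_40 : seq letter := alternating_code
  [:: 1; 2; 3; 4; 5; 1; 6; 7; 4; 8; 2; 6; 9; 5; 8; 3; 7; 9]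
  [:: 1; 3; 4; 6; 8; 9].

Lemma code_9_32P : gauss_code code_9_32 && planar code_9_32.
Proof. by vm_compute. Qed.

Lemma code_9_33P : gauss_code code_9_33 && planar code_9_33.
Proof. by vm_compute. Qed.

Lemma code_9_40P : gauss_code code_9_40 && planar code_9_40.
Proof. by vm_compute. Qed.

Definition knot_9_32 : diagram := Diagram code_9_32P.
Definition knot_9_33 : diagram := Diagram code_9_33P.
Definition knot_9_40 : diagram := Diagram code_9_40P.

(* Main.v *)
From Stdlib Require Import Relations.
From mathcomp Require Import all_boot fingroup ssralg finalg zmodp matrix zify.
Require Import Defs.

Set Implicit Arguments.
Unset Strict Implicit.
Unset Printing Implicit Defensive.

(* Colour the arcs of a diagram by elements of a group so that passing under  *)
(* an arc of colour y turns the colour x into y x^-1 y. Signs and orientation *)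
(* play no role here, and a Reidemeister move changes a colouring without     *)
(* changing the set that its colours generate under this operation. If the    *)
(* roller-coaster algorithm changes at most one crossing, then walking along  *)
(* the diagram from the base point produces every colour from two of them, x  *)
(* at the base point and y at that crossing, so that all colours have the     *)
(* form x (x^-1 y)^n. Colourings of 9_32 and 9_33 by 3 x 3 matrices over a    *)
(* finite field that are not of this form show that two changes are           *)
(* necessary. For the upper bounds, one second and one third Reidemeister     *)
(* move on the diagrams of the table suffice.                                 *)

(** Lower bound: the colours live in the core quandle of a group, and [rich] says that some
    colouring is not generated by two elements. Reidemeister moves respect generation
    ([transfer_move]), so [rich] is a knot invariant ([rich_same_knot]). The base colour and the
    colours over the changed crossings generate all others ([changes_generate]), so a rich knot
    needs at least two changes ([rich_changes], [rich_ascending]). The colours of a two-generated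
    colouring commute once translated to base colour 1 ([not_two_generated]); hence matrix
    colourings with base colour 1 and two noncommuting colours prove richness ([matrix_rich],
    [rich_9_32], [rich_9_33]).

    Upper bound: in each table diagram one strand is pushed across another and slid past a crossing;
    a suitable base point then leaves two, respectively three, changes ([achieved_detour]). *)

Lemma over_opp l : over (opp l) = ~~ over l. Proof. by []. Qed.

Lemma crossing_opp l : crossing (opp l) = crossing l. Proof. by []. Qed.

Lemma gauss_code_uniq w : gauss_code w -> uniq w.
Proof. by case/andP=> /map_uniq. Qed.

Lemma mem_opp w l : gauss_code w -> l \in w -> opp l \in w.
Proof. by case/andP=> _ /allP h /h. Qed.

(** * Core colourings and their behaviour under each move *)

Section Colouring.

Variable G : groupType.
Local Open Scope group_scope.
Implicit Types (c d x y z : G) (phi : nat -> G) (P : G -> Prop).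
Implicit Types (t u v w : seq letter).

Definition core x y : G := y * x^-1 * y.

Lemma corexx x : core x x = x.
Proof. by rewrite /core mulgV mul1g. Qed.

Lemma coreK x y : core (core x y) y = x.
Proof. by rewrite /core !invgM invgK !mulgA mulgV mul1g mulgKV. Qed.

Lemma core_fix x y : core x y = y -> x = y.
Proof. by move=> e; rewrite -[x](coreK x y) e corexx. Qed.

Lemma coreD x y z : core (core x y) z = core (core x z) (core y z).
Proof. by rewrite /core !invgM !invgK !mulgA mulgK mulgKV. Qed.

(* phi n is the colour of the over-strand of crossing n and c the colour at   *)
(* the base point.                                                            *)
Definition pass phi c l : G := if over l then c else core c (phi (crossing l)).
Definition run phi := foldl (pass phi).
Fixpoint valid phi c w : bool :=
  if w is l :: w' then
    (over l ==> (phi (crossing l) == c)) && valid phi (pass phi c l) w'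
  else true.
Definition colouring phi c w : bool := valid phi c w && (run phi c w == c).

Definition colours_in P phi c w : Prop :=
  P c /\ {in w, forall l, P (phi (crossing l))}.
Definition closed P : Prop := forall x y, P x -> P y -> P (core x y).

(** Quantifying over closed predicates expresses generation without constructing the generated
    subquandle. *)
Definition two_generated phi c w : Prop :=
  exists x y, forall P, closed P -> P x -> P y -> colours_in P phi c w.

Definition rich w : Prop :=
  exists phi c, colouring phi c w /\ ~ two_generated phi c w.

(** One inclusion of generated sets is enough: two generators for the new colouring would also
    generate the old one. *)
Definition transfer w w' : Prop := forall phi c, colouring phi c w ->
  exists phi' c', colouring phi' c' w' /\
    forall P, closed P -> colours_in P phi' c' w' -> colours_in P phi c w.

Lemma transfer_rich w w' : transfer w w' -> rich w -> rich w'.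
Proof.
move=> tr [phi [c [col ng]]]; have [phi' [c' [col' sub]]] := tr _ _ col.
exists phi', c'; split=> // -[x [y gen]]; apply: ng.
by exists x, y => P clP Px Py; apply: sub => //; apply: gen.
Qed.

Lemma run_cat phi c u v : run phi c (u ++ v) = run phi (run phi c u) v.
Proof. exact: foldl_cat. Qed.

Lemma valid_cat phi c u v :
  valid phi c (u ++ v) = valid phi c u && valid phi (run phi c u) v.
Proof. by elim: u c => //= l u IH c; rewrite IH andbA. Qed.

Lemma eq_in_run phi phi' c w :
  {in w, forall l, phi (crossing l) = phi' (crossing l)} ->
  run phi c w = run phi' c w.
Proof.
elim: w c => //= l w IH c e; rewrite /pass e ?mem_head // IH // => m mw.
by apply: e; rewrite inE mw orbT.
Qed.

Lemma eq_in_valid phi phi' c w :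
  {in w, forall l, phi (crossing l) = phi' (crossing l)} ->
  valid phi c w = valid phi' c w.
Proof.
elim: w c => //= l w IH c e; rewrite /pass e ?mem_head // IH // => m mw.
by apply: e; rewrite inE mw orbT.
Qed.

Lemma run_in P phi c w : closed P -> colours_in P phi c w -> P (run phi c w).
Proof.
move=> clP; elim: w c => [|l w IH] c [Pc Pw] //=; apply: IH; split.
  rewrite /pass; case: ifP => // _; apply: clP => //.
  by apply: Pw; rewrite mem_head.
by move=> m mw; apply: Pw; rewrite inE mw orbT.
Qed.

Lemma transfer_rot k w : transfer w (rot k w).
Proof.
move=> phi c; rewrite -{1}(cat_take_drop k w) /rot.
move: (take k w) (drop k w) (cat_take_drop k w) => u v wE.
rewrite /colouring valid_cat run_cat => /andP[/andP[vu vv] /eqP e].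
exists phi, (run phi c u); rewrite valid_cat run_cat e vv vu eqxx.
split=> // P clP [Pc Pw].
split; last by move=> l; rewrite -wE mem_cat orbC -mem_cat; apply: Pw.
rewrite -e; apply: run_in => //; split=> // l lv.
by apply: Pw; rewrite mem_cat lv.
Qed.

Lemma valid_rev phi c w : valid phi c w ->
  valid phi (run phi c w) (rev w) /\ run phi (run phi c w) (rev w) = c.
Proof.
elim: w c => //= l w IH c /andP[vl /IH[vw rw]].
rewrite rev_cons -cats1 valid_cat run_cat vw rw /= /pass.
by case: (over l) vl => //=; rewrite ?andbT ?coreK.
Qed.

Lemma transfer_rev w : transfer w (rev w).
Proof.
move=> phi c /andP[/valid_rev[vw rw] /eqP e]; rewrite e in vw rw.
exists phi, c; rewrite /colouring vw rw eqxx; split=> // P _ [Pc Pw].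
by split=> // l lw; apply: Pw; rewrite mem_rev.
Qed.

Definition rename (f : nat -> nat) w : seq letter :=
  [seq (f (crossing l), over l, positive l) | l <- w].

Lemma colouring_rename f phi c w :
  colouring phi c (rename f w) = colouring (phi \o f) c w.
Proof.
rewrite /colouring; congr (_ && (_ == c)).
  by elim: w c => //= l w IH c; rewrite IH.
by elim: w c => //= l w IH c; rewrite IH.
Qed.

Lemma transfer_rename f w : injective f -> transfer w (rename f w).
Proof.
move=> inj_f phi c col; pose s := map crossing w.
(* Inverts [f] on the crossings of [w] by their position in the list; the default 0 is not reached
   there. *)
pose phi' n := phi (nth 0%N s (index n (map f s))).
have e : {in w, forall l, phi (crossing l) = phi' (f (crossing l))}.
  move=> l lw; rewrite /phi' index_map // nth_index //; exact: map_f.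
exists phi', c; split.
  rewrite colouring_rename /colouring -(eq_in_run (phi := phi)) //.
  by rewrite -(eq_in_valid (phi := phi)).
move=> P _ [Pc Pw]; split=> // l lw; rewrite e //.
exact: (Pw _ (map_f (fun l => (f (crossing l), over l, positive l)) lw)).
Qed.

Lemma transfer_unrename f w : transfer (rename f w) w.
Proof.
move=> phi c col; exists (phi \o f), c; rewrite -colouring_rename; split=> //.
by move=> P _ [Pc Pw]; split=> // _ /mapP[l lw ->]; apply: (Pw l).
Qed.

Definition recolour (ns : seq nat) d phi n : G := if n \in ns then d else phi n.

Lemma recolour_fresh ns d phi w :
  ~~ has (fun l => crossing l \in ns) w ->
  {in w, forall l, recolour ns d phi (crossing l) = phi (crossing l)}.
Proof.
by move/hasPn=> fresh l /fresh ns'l; rewrite /recolour (negbTE ns'l).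
Qed.

(** A strand that passes under itself keeps its colour, by [corexx] or [core_fix] according to which
    passage comes first. *)
Lemma transfer_R1 m u : transfer (m :: opp m :: u) u.
Proof.
move=> phi c; rewrite /colouring /= /pass over_opp crossing_opp.
have sub d : d = phi (crossing m) -> forall P, closed P ->
    colours_in P phi d u -> colours_in P phi d (m :: opp m :: u).
  move=> e P _ [Pd Pu]; split=> // l; rewrite !inE.
  by case/or3P=> [/eqP->|/eqP->|/Pu //]; rewrite ?crossing_opp -e.
case om: (over m) => /=.
  case/andP=> /andP[/eqP e vu] ru; rewrite e corexx in vu ru.
  by exists phi, c; rewrite vu; split=> //; apply: sub.
case/andP=> /andP[/eqP e vu] ru; have ec := core_fix (esym e).
rewrite -e -ec in vu ru.
by exists phi, c; rewrite vu; split=> //; apply: sub.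
Qed.

Lemma transfer_unR1 m u : ~~ has (fun l => crossing l \in [:: crossing m]) u ->
  transfer u (m :: opp m :: u).
Proof.
move=> fresh phi c /andP[vu /eqP ru].
have e := recolour_fresh c phi fresh.
exists (recolour [:: crossing m] c phi), c; split.
  rewrite /colouring /= /pass crossing_opp.
  have -> : recolour [:: crossing m] c phi (crossing m) = c.
    by rewrite /recolour mem_head.
  rewrite !corexx !if_same corexx if_same eqxx !implybT /=.
  by rewrite (eq_in_valid _ e) (eq_in_run _ e) vu ru eqxx.
move=> P _ [Pc Pu]; split=> // l lu; rewrite -e //.
by apply: Pu; rewrite !inE lu !orbT.
Qed.

Lemma run2 phi c m n : over m = over n ->
  phi (crossing m) = phi (crossing n) -> valid phi c [:: m; n] ->
  run phi c [:: m; n] = c.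
Proof.
by rewrite /= /pass => <- <-; case: (over m) => //= _; rewrite coreK.
Qed.

Definition bigon m n m' n' : bool :=
  [&& over m == over n, over m' == ~~ over m, over n' == ~~ over m &
      ((crossing m', crossing n') == (crossing m, crossing n)) ||
      ((crossing m', crossing n') == (crossing n, crossing m))].

Lemma bigon_colour phi c m n m' n' u : bigon m n m' n' ->
  valid phi c ([:: m; n] ++ u ++ [:: m'; n']) ->
  phi (crossing m) = phi (crossing n) /\ phi (crossing m') = phi (crossing n').
Proof.
case/and4P=> /eqP omn /eqP om' /eqP on' sub.
rewrite !valid_cat /= /pass om' on' -omn.
case/andP=> /and3P[vm vn _] /andP[_ /and3P[vm' vn' _]].
suff e : phi (crossing m) = phi (crossing n).
  by split=> //; case/orP: sub => /eqP[-> ->].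
case: (over m) vm vn vm' vn' => [/eqP-> /eqP-> //|_ _ /= /eqP e1 /eqP e2].
by case/orP: sub e1 e2 => /eqP[-> ->] h h'; rewrite (etrans h (esym h')).
Qed.

(** Both crossings have the same upper colour, and passing twice under it cancels by [coreK]. *)
Lemma transfer_R2 m n m' n' u v : bigon m n m' n' ->
  transfer ([:: m; n] ++ u ++ [:: m'; n'] ++ v) (u ++ v).
Proof.
move=> mn phi c; rewrite /colouring [u ++ _]catA catA => /andP[].
rewrite valid_cat => /andP[v1 v2] /eqP r.
have [e e'] := bigon_colour mn v1.
move: v1 v2 r; rewrite !run_cat !valid_cat.
case/and4P: mn => /eqP omn /eqP om' /eqP on' sub.
have omn' : over m' = over n' by rewrite om' on'.
case/and3P=> v1 vu v1'; rewrite (run2 omn e v1) in vu v1' *.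
rewrite (run2 omn' e' v1') => vv r.
exists phi, c; rewrite valid_cat run_cat vu vv r eqxx.
split=> // P clP [Pc Puv].
(* The upper colour survives the removal of the bigon: it is the colour at the base point or the one
   after [u]. *)
have Pm : P (phi (crossing m)).
  have Pd : P (run phi c u).
    by apply: run_in => //; split=> // l lu; apply: Puv; rewrite mem_cat lu.
  move: v1 v1'; rewrite /= /pass om' => /andP[vm _] /andP[vm' _].
  case: (over m) vm vm' => [/eqP-> //|_ /= /eqP].
  by case/orP: sub => /eqP[-> _]; rewrite -?e => ->.
split=> // l; rewrite !mem_cat !inE -!orbA.
case/or4P=> [/eqP->//|/eqP->|lu|]; first by rewrite -e.
  by apply: Puv; rewrite mem_cat lu.
case/or3P=> [/eqP->|/eqP->|lv]; last by apply: Puv; rewrite mem_cat lv orbT.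
  by case/orP: sub => /eqP[-> _]; rewrite -?e.
by case/orP: sub => /eqP[_ ->]; rewrite -?e.
Qed.

Lemma transfer_unR2 m n m' n' u v : bigon m n m' n' ->
  ~~ has (fun l => crossing l \in [:: crossing m; crossing n]) (u ++ v) ->
  transfer (u ++ v) ([:: m; n] ++ u ++ [:: m'; n'] ++ v).
Proof.
move=> mn; rewrite has_cat negb_or => /andP[fu fv] phi c.
rewrite /colouring valid_cat run_cat => /andP[/andP[vu vv] /eqP r].
set d := if over m then c else run phi c u.
set phi' := recolour [:: crossing m; crossing n] d phi.
have eu := recolour_fresh d phi fu; have ev := recolour_fresh d phi fv.
case/and4P: mn => /eqP omn /eqP om' /eqP on' sub.
have omn' : over m' = over n' by rewrite om' on'.
have em : phi' (crossing m) = d by rewrite /phi' /recolour mem_head.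
have en : phi' (crossing n) = d by rewrite /phi' /recolour !inE eqxx orbT.
have [em' en'] : phi' (crossing m') = d /\ phi' (crossing n') = d.
  by case/orP: sub => /eqP[-> ->].
have v1 : valid phi' c [:: m; n].
  by rewrite /= /pass em en -omn /d; case: (over m); rewrite //= !eqxx.
have v1' : valid phi' (run phi c u) [:: m'; n'].
  by rewrite /= /pass em' en' om' on' /d; case: (over m); rewrite //= !eqxx.
have e : phi' (crossing m) = phi' (crossing n) by rewrite em en.
have e' : phi' (crossing m') = phi' (crossing n') by rewrite em' en'.
exists phi', c; split.
  rewrite !valid_cat !run_cat v1 (run2 omn e v1).
  rewrite (eq_in_valid _ eu) (eq_in_run _ eu) vu v1' (run2 omn' e' v1').
  by rewrite (eq_in_valid _ ev) (eq_in_run _ ev) vv r eqxx.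
move=> P _ [Pc Pw]; split=> // l; rewrite mem_cat => /orP[] lu.
  by rewrite -eu //; apply: Pw; rewrite !mem_cat lu !orbT.
by rewrite -ev //; apply: Pw; rewrite !mem_cat lu !orbT.
Qed.

(* The sides of the triangle of a third Reidemeister move: p and q are the    *)
(* crossings on the top strand, r is the crossing of the two other strands.   *)
Definition top p q m n : bool :=
  [&& over m, over n & ((crossing m, crossing n) == (p, q)) ||
                       ((crossing m, crossing n) == (q, p))].
Definition low p q r m n : bool :=
  [&& ~~ over m, crossing m \in [:: p; q] & crossing n == r] ||
  [&& ~~ over n, crossing n \in [:: p; q] & crossing m == r].
Definition side p q r m n : bool := top p q m n || low p q r m n.

Lemma top_colour p q m n phi c :
  top p q m n -> valid phi c [:: m; n] -> phi p = phi q.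
Proof.
case/and3P=> om on; rewrite /= /pass om on /= andbT => mn.
case/andP=> /eqP vm /eqP vn.
by case/orP: mn vm vn => /eqP[-> ->] -> ->.
Qed.

(* Only the arc of the middle strand that joins its two crossings changes its *)
(* colour, by reflection in the colour of the top strand.                     *)
Lemma side_swap p q r m n phi c : side p q r m n ->
  p != r -> q != r -> phi p = phi q -> valid phi c [:: m; n] ->
  let phi' := recolour [:: r] (core (phi r) (phi p)) phi in
  valid phi' c [:: n; m] /\ run phi' c [:: n; m] = run phi c [:: m; n].
Proof.
move=> s pr qr epq v phi'.
have er : phi' r = core (phi r) (phi p) by rewrite /phi' /recolour mem_head.
have ep : phi' p = phi p by rewrite /phi' /recolour inE (negbTE pr).
have eq : phi' q = phi p by rewrite /phi' /recolour inE (negbTE qr).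
case/or3P: s v => /and3P[].
- move=> om on mn; rewrite /= /pass om on /= !andbT => /andP[vm vn].
  by case/orP: mn vm vn => /eqP[-> ->]; rewrite ep eq -epq => ->.
- move=> om mpq /eqP en; rewrite /= /pass (negbTE om) en er /=.
  have [-> ->] : phi (crossing m) = phi p /\ phi' (crossing m) = phi p.
    by move: mpq; rewrite !inE => /orP[] /eqP->; rewrite ?ep ?eq.
  (* With [over n] this is the middle strand; otherwise it is the bottom one, which needs
     self-distributivity. *)
  case: (over n) => /=; rewrite ?andbT; last by rewrite coreD coreK.
  by move=> /eqP->; rewrite coreK.
move=> on npq /eqP em; rewrite /= /pass (negbTE on) em er /=.
have [-> ->] : phi (crossing n) = phi p /\ phi' (crossing n) = phi p.
  by move: npq; rewrite !inE => /orP[] /eqP->; rewrite ?ep ?eq.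
case: (over m) => /=; rewrite ?andbT; last by rewrite -coreD.
by move=> /eqP->.
Qed.

Lemma transfer_R3 (p q r : nat) (x x' y y' z z' : letter) t u v :
  p != r -> q != r ->
  side p q r x x' -> side p q r y y' -> side p q r z z' ->
  [|| top p q x x', top p q y y' | top p q z z'] ->
  ~~ has (fun l => crossing l \in [:: r]) (t ++ u ++ v) ->
  transfer ([:: x; x'] ++ t ++ [:: y; y'] ++ u ++ [:: z; z'] ++ v)
           ([:: x'; x] ++ t ++ [:: y'; y] ++ u ++ [:: z'; z] ++ v).
Proof.
move=> pr qr sx sy sz tp fresh phi c; rewrite /colouring !valid_cat !run_cat.
case/andP=> /and5P[vx vt vy vu /andP[vz vv]] /eqP e.
have epq : phi p = phi q.
  by case/or3P: tp => tp; [move: vx|move: vy|move: vz]; apply: top_colour.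
set phi' := recolour [:: r] (core (phi r) (phi p)) phi.
have [fvt fvu fvv] : [/\ {in t, forall l, phi' (crossing l) = phi (crossing l)},
    {in u, forall l, phi' (crossing l) = phi (crossing l)} &
    {in v, forall l, phi' (crossing l) = phi (crossing l)}].
  move: fresh; rewrite !has_cat !negb_or => /and3P[].
  by split; apply: recolour_fresh.
have [vx' rx'] := side_swap sx pr qr epq vx.
have [vy' ry'] := side_swap sy pr qr epq vy.
have [vz' rz'] := side_swap sz pr qr epq vz.
exists phi', c; split.
  rewrite !valid_cat !run_cat vx' rx' (eq_in_valid _ fvt) vt (eq_in_run _ fvt).
  rewrite vy' ry' (eq_in_valid _ fvu) vu (eq_in_run _ fvu).
  by rewrite vz' rz' (eq_in_valid _ fvv) vv (eq_in_run _ fvv) e eqxx.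
move=> P clP [Pc Pw]; split=> // l.
set w' := (X in {in X, _}) in Pw.
have memw : w' =i [:: x; x'] ++ t ++ [:: y; y'] ++ u ++ [:: z; z'] ++ v.
  move=> k; rewrite !mem_cat !inE.
  by rewrite (orbC (k == x')) (orbC (k == y')) (orbC (k == z')).
rewrite -memw => lw; have := Pw _ lw; rewrite /phi' /recolour inE.
case: eqP => [-> Pr|//].
have Pp : P (phi p).
  have /mapP[k kw ek] : p \in map crossing w'.
    rewrite /w' !map_cat !mem_cat /=.
    by case/or3P: tp => /and3P[_ _ /orP[]] /eqP[-> ->]; rewrite !inE eqxx ?orbT.
  by have := Pw _ kw; rewrite -ek /phi' /recolour inE (negbTE pr).
(* The lost colour of [r] is the reflection of its new colour in that of the top strand. *)
by rewrite -[phi r](coreK _ (phi p)); apply: clP.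
Qed.

End Colouring.

(** * Combinatorics of Gauss codes and triangular faces *)

Lemma topC p q m n : top p q m n = top p q n m.
Proof.
by rewrite /top andbCA !xpair_eqE orbC ![(crossing m == _) && _]andbC.
Qed.

Lemma sideC p q r m n : side p q r m n = side p q r n m.
Proof. by rewrite /side topC; congr (_ || _); apply: orbC. Qed.

Lemma gauss_code_inj w l m : gauss_code w -> l \in w -> m \in w ->
  crossing l = crossing m -> over l = over m -> l = m.
Proof.
case/andP=> + _; elim: w => //= k w IH /andP[kw /IH{}IH].
have new n : n \in w -> crossing k = crossing n -> over k <> over n.
  by move=> nw ec eo; case/negP: kw; rewrite ec eo; apply: map_f.
rewrite !inE => /predU1P[->|lw] /predU1P[->|mw] // ec eo.
- by case: (new _ mw).
- by case: (new _ lw).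
exact: IH.
Qed.

Lemma next_cat (T : eqType) (s t : seq T) m n :
  uniq (s ++ m :: n :: t) -> next (s ++ m :: n :: t) m = n.
Proof.
move=> u; rewrite next_nth mem_cat mem_head orbT.
case: s u => [|k s] /=; first by rewrite eqxx.
case/andP=> ks; rewrite cat_uniq => /and3P[_ /hasPn ms _].
have /negbTE -> : k != m.
  by apply: contraNneq ks => ->; rewrite mem_cat mem_head orbT.
have /negbTE sm := ms _ (mem_head _ _).
by rewrite index_cat sm /= eqxx addn0 nth_cat ltnNge leqnSn /= subSnn.
Qed.

(** A crossing has only two passages. This frees the crossings of [ms] for recolouring without
    affecting [r]. *)
Lemma gauss_fresh w s r ms : gauss_code w -> perm_eq w (s ++ r) ->
  all (fun m => (m \in s) && (opp m \in s)) ms ->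
  ~~ has (fun l => crossing l \in map crossing ms) r.
Proof.
move=> gw pw /allP sub; apply/hasPn=> l lr.
apply/negP=> /mapP[m /sub/andP[sm som] e].
have := gauss_code_uniq gw; rewrite (perm_uniq pw) cat_uniq.
case/and3P=> _ /hasPn/(_ l lr) ls _.
have inw n : (n \in s) || (n \in r) -> n \in w.
  by rewrite (perm_mem pw) mem_cat.
case: (eqVneq (over l) (over m)) => o.
  by move: ls; rewrite (gauss_code_inj gw _ _ e o) ?inw ?lr ?orbT ?sm.
move: ls; rewrite (gauss_code_inj (m := opp m) gw _ _ e) ?inw ?lr ?orbT ?som //.
by move: o; rewrite /opp /over /=; case: l.1.2 m.1.2 => [] [].
Qed.

Definition fin w (e : dart) := if e.2 then next w e.1 else e.1.
Definition start w (e : dart) := if e.2 then e.1 else next w e.1.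

(** A turn always leaves on the other strand of the crossing; the sign only decides the
    direction. *)
Lemma start_turn w e : uniq w -> start w (turn w e) = opp (fin w e).
Proof.
move=> u; rewrite /turn -/(fin w e); case: (_ == e.2); rewrite /start //=.
exact: next_prev.
Qed.

Lemma side_dart w p q r e :
  side p q r (start w e) (fin w e) = side p q r e.1 (next w e.1).
Proof. by rewrite /start /fin; case: e.2; rewrite // sideC. Qed.

Lemma top_dart w p q e :
  top p q (start w e) (fin w e) = top p q e.1 (next w e.1).
Proof. by rewrite /start /fin; case: e.2; rewrite // topC. Qed.

Lemma cycle_sides w e1 e2 e3 : uniq w ->
  turn w e1 = e2 -> turn w e2 = e3 -> turn w e3 = e1 ->
  uniq [:: crossing (fin w e1); crossing (fin w e2); crossing (fin w e3)] ->
  over e1.1 && over (next w e1.1) ->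
  exists p q r, [/\ p != r, q != r, r = crossing (fin w e2),
    top p q e1.1 (next w e1.1) &
    {in [:: e1; e2; e3], forall e, side p q r e.1 (next w e.1)}].
Proof.
move=> u t1 t2 t3; rewrite /= !inE negb_or andbT -andbA.
case/and3P=> n12 n13 n23 tp.
exists (crossing (fin w e3)), (crossing (fin w e1)), (crossing (fin w e2)).
have := start_turn e3 u; rewrite t3 => s1.
have := start_turn e1 u; rewrite t1 => s2.
have := start_turn e2 u; rewrite t2 => s3.
have [o1 o2] : over (start w e1) /\ over (fin w e1).
  by move: tp; rewrite /start /fin; case: e1.2 => /andP[].
have o3 : ~~ over (fin w e3) by move: o1; rewrite s1.
have T : top (crossing (fin w e3)) (crossing (fin w e1))
    (start w e1) (fin w e1).
  by rewrite /top o1 o2 s1 eqxx.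
split=> //; first by rewrite eq_sym.
  by rewrite -top_dart.
move=> e; rewrite !inE -side_dart /side => /or3P[] /eqP->; first by rewrite T.
  by rewrite /low s2 over_opp crossing_opp o2 !inE !eqxx !orbT.
by rewrite /low s3 crossing_opp o3 !inE !eqxx !orbT.
Qed.

(** The end of the second dart differs from both passages through the end of the first. *)
Lemma crossing_fin w e :
  gauss_code w -> fin w e \in w -> fin w (turn w e) \in w ->
  uniq [:: e.1; (turn w e).1; next w e.1; next w (turn w e).1] ->
  crossing (fin w e) != crossing (fin w (turn w e)).
Proof.
move=> gw ew ew' u; apply/eqP=> ec.
have s := start_turn e (gauss_code_uniq gw).
have [ne ns] : fin w e != fin w (turn w e) /\
    start w (turn w e) != fin w (turn w e).
  move: u; rewrite /= !inE !negb_or /start /fin.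
  case/and4P=> /and3P[n1 n2 n3] /andP[n4 n5] n6 _.
  by split; case: e.2; case: (turn w e).2; rewrite // eq_sym.
case: (eqVneq (over (fin w e)) (over (fin w (turn w e)))) => o.
  by case/eqP: ne; apply: (gauss_code_inj gw).
case/eqP: ns; rewrite s; apply: (gauss_code_inj gw) => //.
  exact: mem_opp.
by rewrite over_opp; case: (over _) (over _) o => [] [].
Qed.

Definition layered w p q s : Prop := exists m,
  [/\ p != crossing m, q != crossing m,
  {in s, forall n, side p q (crossing m) n (next w n)},
  has (fun n => top p q n (next w n)) s &
  (m \in s ++ map (next w) s) && (opp m \in s ++ map (next w) s)].

Lemma turn3_layered w e1 e2 e3 s : gauss_code w ->
  turn w e1 = e2 -> turn w e2 = e3 -> turn w e3 = e1 ->
  perm_eq (unzip1 [:: e1; e2; e3]) s -> uniq (s ++ map (next w) s) ->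
  {subset s <= w} -> over e1.1 && over (next w e1.1) ->
  exists p q, layered w p q s.
Proof.
move=> gw t1 t2 t3 pe us sw te; have gu := gauss_code_uniq gw.
have su : uniq (unzip1 [:: e1; e2; e3] ++
                map (next w) (unzip1 [:: e1; e2; e3])).
  by rewrite (perm_uniq (perm_cat pe (perm_map _ pe))).
have es e : e \in [:: e1; e2; e3] -> e.1 \in s.
  by move=> fe; rewrite -(perm_mem pe) map_f.
have ew e : e \in [:: e1; e2; e3] -> fin w e \in w.
  by move=> /es/sw fw; rewrite /fin; case: ifP => // _; rewrite mem_next.
have [i1 i2 i3] : [/\ e1 \in [:: e1; e2; e3], e2 \in [:: e1; e2; e3] &
    e3 \in [:: e1; e2; e3]].
  by rewrite !inE !eqxx !orbT.
have n12 : crossing (fin w e1) != crossing (fin w e2).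
  rewrite -t1; apply: crossing_fin; rewrite ?t1 ?ew //.
  exact: (mask_uniq su [:: true; true; false; true; true; false]).
have n23 : crossing (fin w e2) != crossing (fin w e3).
  rewrite -t2; apply: crossing_fin; rewrite ?t2 ?ew //.
  exact: (mask_uniq su [:: false; true; true; false; true; true]).
have n31 : crossing (fin w e3) != crossing (fin w e1).
  rewrite -t3; apply: crossing_fin; rewrite ?t3 ?ew //.
  have := mask_uniq su [:: true; false; true; true; false; true]; rewrite /=.
  rewrite !inE !negb_or ![e3.1 == _]eq_sym ![next w e3.1 == _]eq_sym.
  by case/and4P=> /and3P[-> -> ->] /andP[-> ->] ->.
have [|p [q [r [pr qr rE tp sd]]]] := cycle_sides gu t1 t2 t3 _ te.
  by rewrite /= !inE negb_or n12 n23 eq_sym n31.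
exists p, q, (fin w e2); rewrite -rE; split=> //.
- by move=> n; rewrite -(perm_mem pe) => /mapP[e ee ->]; apply: sd.
- by rewrite -(perm_has _ pe) /= tp.
rewrite -(start_turn e2 gu) t2.
by rewrite /fin /start; case: e2.2; case: e3.2;
  rewrite !mem_cat ?map_f ?es // ?orbT.
Qed.

Lemma perm_sides (T : eqType) (x x' y y' z z' : T) t u v :
  perm_eq ([:: x; x'] ++ t ++ [:: y; y'] ++ u ++ [:: z; z'] ++ v)
    ([:: x; y; z; x'; y'; z'] ++ t ++ u ++ v).
Proof.
by apply/permP=> a; rewrite /= !count_cat /= ?count_cat /= ?count_cat /=; lia.
Qed.

Lemma triangle_sides w x y z x' y' z' r : gauss_code w ->
  triangle w x y z -> perm_eq w ([:: x; y; z; x'; y'; z'] ++ r) ->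
  next w x = x' -> next w y = y' -> next w z = z' ->
  [|| over x && over x', over y && over y' | over z && over z'] ->
  exists p q n, [/\ p != n /\ q != n,
    side p q n x x', side p q n y y' /\ side p q n z z',
    [|| top p q x x', top p q y y' | top p q z z'] &
    ~~ has (fun l => crossing l \in [:: n]) r].
Proof.
move=> gw /hasP[d _ /andP[/eqP t3]] + pw nx ny nz to.
set e1 := (x, d) in t3 *; set e2 := turn w e1; set e3 := turn w e2 => pe.
have us : uniq ([:: x; y; z] ++ map (next w) [:: x; y; z]).
  rewrite /= nx ny nz.
  by have := gauss_code_uniq gw; rewrite (perm_uniq pw) cat_uniq => /and3P[].
have sw : {subset [:: x; y; z] <= w}.
  move=> n sn; rewrite (perm_mem pw) mem_cat -[_ :: _]/([:: x; y; z] ++ _).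
  by rewrite mem_cat sn.
have {}to : has (fun m => over m && over (next w m)) [:: x; y; z].
  by rewrite /= nx ny nz orbF.
rewrite -(perm_has _ pe) /= orbF in to.
have [p [q [m [pm qm sd tp ms]]]] : exists p q, layered w p q [:: x; y; z].
  (* Rotate the face so that its top side comes first. *)
  case/or3P: to => to; first exact: (turn3_layered gw _ _ _ pe us sw to).
    apply: (turn3_layered (e2 := e3) (e3 := e1) gw _ _ _ _ us sw to) => //.
    exact: perm_trans (permEl (perm_rot 1 (unzip1 [:: e1; e2; e3]))) pe.
  apply: (turn3_layered (e2 := e1) (e3 := e2) gw _ _ _ _ us sw to) => //.
  exact: perm_trans (permEl (perm_rot 2 (unzip1 [:: e1; e2; e3]))) pe.
exists p, q, (crossing m); split=> //.
- by rewrite -nx sd // !inE eqxx.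
- by rewrite -ny -nz !sd // !inE eqxx !orbT.
- by move: tp; rewrite /= nx ny nz orbF.
apply: (gauss_fresh (ms := [:: m]) gw pw).
by move: ms; rewrite /= nx ny nz andbT.
Qed.

(** * Every move transfers colourings in both directions *)

Section Moves.

Variable G : groupType.
Local Notation transfer := (transfer G).

Lemma transfer_bigon m n m' n' u v : bigon m n m' n' ->
  perm_eq [:: m'; n'] [:: opp m; opp n] ->
  gauss_code ([:: m; n] ++ u ++ [:: m'; n'] ++ v) ->
  transfer ([:: m; n] ++ u ++ [:: m'; n'] ++ v) (u ++ v) /\
  transfer (u ++ v) ([:: m; n] ++ u ++ [:: m'; n'] ++ v).
Proof.
move=> mn pe gw; split; first exact: transfer_R2.
apply: transfer_unR2 => //.
apply: (gauss_fresh (s := [:: m; n; opp m; opp n]) (ms := [:: m; n]) gw).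
  rewrite -[[:: m; n; opp m; opp n]]/([:: m; n] ++ [:: opp m; opp n]).
  by rewrite -catA perm_cat2l perm_catCA perm_cat2r.
by rewrite /= !inE !eqxx !orbT.
Qed.

Lemma transfer_move w w' : gauss_code w -> gauss_code w' -> move w w' ->
  transfer w w' /\ transfer w' w.
Proof.
move=> gw gw' m; case: m gw gw' => {w w'} /=.
- move=> f w inj_f _ _; split; first exact: transfer_rename.
  exact: transfer_unrename.
- move=> k w _ _; split; first exact: transfer_rot.
  by rewrite -{2}[w](rotK k); apply: transfer_rot.
- move=> w _ _; split; first exact: transfer_rev.
  by rewrite -{2}[w]revK; apply: transfer_rev.
- move=> m u gw _; split; first exact: transfer_R1.
  apply: transfer_unR1.
  apply: (gauss_fresh (s := [:: m; opp m]) (ms := [:: m]) gw) => //=.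
  by rewrite !inE !eqxx orbT.
- move=> m n u v omn _ gw _; apply: (@transfer_bigon m n (opp m) (opp n)) => //.
  by rewrite /bigon !over_opp omn !eqxx.
- move=> m n u v omn _ gw _; apply: (@transfer_bigon m n (opp n) (opp m)) => //.
    by rewrite /bigon !over_opp omn !eqxx orbT.
  exact: permEl (perm_rev [:: opp m; opp n]).
move=> x x' y y' z z' t u v tri to gw _.
set w := (X in gauss_code X) in gw tri *.
have pw : perm_eq w ([:: x; y; z; x'; y'; z'] ++ t ++ u ++ v).
  exact: perm_sides.
have nx : next w x = x'.
  by apply: (next_cat (s := [::])); apply: gauss_code_uniq.
have ny : next w y = y'.
  by apply: (next_cat (s := [:: x, x' & t])); apply: gauss_code_uniq.
have nz : next w z = z'.
  have := @next_cat _ ([:: x, x' & t] ++ [:: y, y' & u]) v z z'.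
  by rewrite -catA; apply; apply: gauss_code_uniq.
have [p [q [n [[pn qn] sx [sy sz] tp fresh]]]] :=
  triangle_sides gw tri pw nx ny nz to.
split; first exact: transfer_R3 pn qn sx sy sz tp fresh.
(* The conditions on the sides are symmetric in their two letters, so the inverse move is another
   instance. *)
apply: transfer_R3 pn qn _ _ _ _ fresh; try by rewrite sideC.
by rewrite topC [top _ _ y' _]topC [top _ _ z' _]topC.
Qed.

End Moves.

(** * Rich knots need at least two changes *)

Section LowerBound.

Variable G : groupType.
Local Open Scope group_scope.
Implicit Types (c x y z : G) (phi : nat -> G) (w : seq letter).

Lemma code_gauss D : gauss_code (code D).
Proof. by case: D => w /= /andP[]. Qed.

Lemma rich_same_knot D D' :
  same_knot D D' -> rich G (code D) <-> rich G (code D').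
Proof.
elim=> {D D'} [D D' m|//|D D' _ IH|D D' D'' _ IH _ IH'].
- have [t t'] := transfer_move G (code_gauss D) (code_gauss D') m.
  by split; apply: transfer_rich.
- exact: iff_sym.
exact: iff_trans IH IH'.
Qed.

(** Induction on prefixes of the walk: an over-passage shows the current colour, and an
    under-passage meets either a changed crossing or one already passed over. *)
Lemma changes_generate (P : G -> Prop) phi c w :
  gauss_code w -> valid phi c w -> closed P -> P c ->
  {in roller_coaster_changes w, forall n, P (phi n)} -> colours_in P phi c w.
Proof.
move=> gw vw clP Pc Pch; have gu := gauss_code_uniq gw.
suff pre u v : w = u ++ v -> colours_in P phi c u.
  by apply: (pre _ [::]); rewrite cats0.
elim/last_ind: u v => [//|u l IH] v; rewrite cat_rcons => e.
have [_ Pu] := IH _ e; split=> // k.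
rewrite mem_rcons inE => /predU1P[->|/Pu //].
have lw : l \in w by rewrite e mem_cat mem_head orbT.
case ol: (over l).
  move: vw; rewrite e valid_cat => /andP[_ /=]; rewrite ol => /andP[/eqP-> _].
  exact: run_in.
case: (ltnP (index l w) (index (opp l) w)) => il.
  by apply: Pch; apply: map_f; rewrite mem_filter ol il.
have lu : l \notin u.
  by move: gu; rewrite e cat_uniq => /and3P[_ /hasPn/(_ _ (mem_head _ _))].
rewrite -crossing_opp; apply: Pu; apply: contraLR il => olu; rewrite -ltnNge.
rewrite e !index_cat (negbTE lu) (negbTE olu) /= eqxx addn0.
have /negbTE -> : l != opp l.
  by apply/eqP=> /(congr1 over); rewrite over_opp; case: (over l).
by rewrite addnS ltnS leq_addr.
Qed.

Lemma rich_changes w :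
  gauss_code w -> rich G w -> 1 < size (roller_coaster_changes w).
Proof.
move=> gw [phi [c [/andP[vw _] ng]]]; rewrite ltnNge.
apply/negP=> le1; apply: ng.
exists c, (if roller_coaster_changes w is n :: _ then phi n else c).
move=> P clP Pc Pd.
apply: changes_generate => // n.
case: (roller_coaster_changes w) le1 Pd => [|k []] //= _ Pk.
by rewrite inE => /eqP->.
Qed.

Lemma rich_ascending K : rich G (code K) -> 1 < ascending_number K.
Proof.
move=> rK; rewrite /ascending_number.
case: ex_minnP => n /boolp.asboolP[D KD <-] _.
by apply: rich_changes; [apply: code_gauss | apply/(rich_same_knot KD)].
Qed.

(* The double centralizer of x^-1 * y stands in for the cyclic group that it  *)
(* generates.                                                                 *)
Lemma not_two_generated phi c w l m : l \in w -> m \in w ->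
  ~ commute (c^-1 * phi (crossing l)) (c^-1 * phi (crossing m)) ->
  ~ two_generated phi c w.
Proof.
move=> lw mw nc [x [y gen]]; apply: nc; set k := x^-1 * y.
pose P z := forall h, commute h k -> commute h (x^-1 * z).
have clP : closed P.
  move=> z z' Pz Pz' h hk.
  have -> : x^-1 * core z z' = x^-1 * z' * (x^-1 * z)^-1 * (x^-1 * z').
    by rewrite /core invgM invgK !mulgA mulgK.
  apply: commuteM; last exact: Pz'.
  by apply: commuteM; [apply: Pz'|apply/commuteV/Pz].
have Px : P x by move=> h _; rewrite mulVg; apply: commute1.
have Py : P y by move=> h.
have [Pc Pw] := gen P clP Px Py.
have Pl := Pw _ lw; have Pm := Pw _ mw.
(* The double centralizer of [k] is commutative, since [k] commutes with itself. *)
have kP z : P z -> commute (x^-1 * z) k by move=> Pz; apply/commute_sym/Pz.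
have PP z z' : P z -> P z' -> commute (x^-1 * z) (x^-1 * z').
  by move=> /kP + Pz'; apply: Pz'.
have cE z : c^-1 * z = (x^-1 * c)^-1 * (x^-1 * z).
  by rewrite invgM invgK !mulgA mulgK.
rewrite !{}cE.
have V z z' : commute z z' -> commute z^-1 z'.
  by move=> /commute_sym/commuteV/commute_sym.
have M z z' z'' : commute z z'' -> commute z' z'' -> commute (z * z') z''.
  by move=> /commute_sym h /commute_sym h'; apply/commute_sym/commuteM.
by apply: M; [apply: V|]; apply: commuteM; try apply: commuteV; apply: PP.
Qed.

Lemma not_two_generated1 phi w l m : l \in w -> m \in w ->
  ~ commute (phi (crossing l)) (phi (crossing m)) -> ~ two_generated phi 1 w.
Proof.
by move=> lw mw nc; apply: (not_two_generated lw mw); rewrite invg1 !mul1g.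
Qed.

End LowerBound.

(** * Computable colourings by invertible matrices *)

Section MatrixColouring.

Variable p : nat.
Hypothesis p_gt1 : 1 < p.
Local Notation GL := {'GL_3['Z_p]}.
Local Notation mat := (seq (seq nat)).
Implicit Types (s t : mat) (a b : mat * mat).

Definition entry s i j : nat := nth 0 (nth [::] s i) j.

Definition mul3 s t : mat :=
  mkseq (fun i => mkseq (fun j =>
    sumn [seq entry s i k * entry t k j | k <- iota 0 3] %% p) 3) 3.

Definition mx3 s : 'M['Z_p]_3 := (\matrix_(i, j) (entry s i j)%:R)%R.

Lemma mx3M s t : mx3 (mul3 s t) = (mx3 s *m mx3 t)%R.
Proof.
apply/matrixP=> i j; rewrite !mxE /entry !nth_mkseq //.
rewrite Zp_nat_mod // -[RHS]/(\sum_(k < 3) _)%R !big_ord_recl big_ord0 !mxE.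
by rewrite /= addn0 !GRing.natrD !GRing.natrM GRing.addr0.
Qed.

Lemma mx3_entry s t i j : i < 3 -> j < 3 -> mx3 s = mx3 t ->
  entry s i j = entry t i j %[mod p].
Proof.
move=> i3 j3 /matrixP/(_ (Ordinal i3) (Ordinal j3)); rewrite !mxE /=.
by move/(congr1 val); rewrite /= !val_Zp_nat.
Qed.

Definition id3 : mat := [:: [:: 1; 0; 0]; [:: 0; 1; 0]; [:: 0; 0; 1]].

Lemma mx3_id : mx3 id3 = 1%:M%R.
Proof.
by apply/matrixP=> -[[|[|[]]] //= ?] [[|[|[]]] //= ?]; rewrite !mxE.
Qed.

(* A matrix is carried along with its inverse, which makes the operation on   *)
(* colours computable.                                                        *)
Definition inverse3 a : bool := mul3 a.1 a.2 == id3.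

(** On a singular matrix [insubd] falls back to the identity, hence the certified inverse required
    in [gl3E]. *)
Definition gl3 a : GL := insubd (1%g : GL) (mx3 a.1 : 'M_3.-1.+1).

Lemma gl3E a : inverse3 a ->
  GLval (gl3 a) = mx3 a.1 /\ GLval (gl3 a)^-1%g = mx3 a.2.
Proof.
move=> /eqP ia.
have e : (mx3 a.1 *m mx3 a.2 = 1%:M)%R by rewrite -mx3M ia mx3_id.
have [u1 u2] := mulmx1_unit e.
have v : GLval (gl3 a) = mx3 a.1 by rewrite /gl3 val_insubd u1.
by split=> //; rewrite GL_VxE v -[RHS](mulKmx u1) e mulmx1.
Qed.

Definition core3 a b := (mul3 (mul3 b.1 a.2) b.1, mul3 (mul3 b.2 a.1) b.2).

Lemma core3E a b : inverse3 a -> inverse3 b -> inverse3 (core3 a b) ->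
  gl3 (core3 a b) = core (gl3 a) (gl3 b).
Proof.
move=> /gl3E[va va'] /gl3E[vb vb'] /gl3E[vc _].
by apply: val_inj; rewrite [LHS]vc /core /= !mx3M -va' -vb.
Qed.

(** Colours are compared as lists of numbers, which is sound because equal lists give equal
    matrices; [d] is the colour expected at the end. *)
Fixpoint valid3 (f : nat -> mat * mat) c d w : bool :=
  inverse3 c &&
  if w is l :: w' then
    if over l then (f (crossing l) == c) && valid3 f c d w'
    else inverse3 (f (crossing l)) && valid3 f (core3 c (f (crossing l))) d w'
  else c == d.

Lemma valid3P f c d w : valid3 f c d w ->
  valid (gl3 \o f) (gl3 c) w /\ run (gl3 \o f) (gl3 c) w = gl3 d.
Proof.
elim: w c => [|l w IH] c /=; first by case/andP=> _ /eqP->.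
rewrite /pass; case: (over l) => /= /and3P[ic].
  by move=> /eqP-> /IH; rewrite eqxx.
move=> il v; have il' : inverse3 (core3 c (f (crossing l))).
  by case: w v {IH} => [|k w] /= /andP[].
by rewrite -core3E //; apply: IH.
Qed.

Lemma gl3_commute a b : inverse3 a -> inverse3 b ->
  commute (gl3 a) (gl3 b) -> mx3 (mul3 a.1 b.1) = mx3 (mul3 b.1 a.1).
Proof.
move=> /gl3E[aE _] /gl3E[bE _] /(congr1 (@GLval _ _)).
by rewrite !mx3M -aE -bE.
Qed.

Lemma gl3_id : gl3 (id3, id3) = 1%g.
Proof. by apply: val_inj; rewrite /= /gl3 val_insubd mx3_id unitmx1. Qed.

Lemma matrix_rich (f : nat -> mat * mat) w l m i j :
  valid3 f (id3, id3) (id3, id3) w -> l \in w -> m \in w ->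
  let a := f (crossing l) in let b := f (crossing m) in
  inverse3 a -> inverse3 b -> i < 3 -> j < 3 ->
  entry (mul3 a.1 b.1) i j != entry (mul3 b.1 a.1) i j %[mod p] -> rich GL w.
Proof.
move=> v lw mw a b ia ib i3 j3 /eqP ab.
have := valid3P v; rewrite gl3_id => -[vw rw].
exists (gl3 \o f), (1%g : GL); split; first by rewrite /colouring vw rw eqxx.
apply: (not_two_generated1 lw mw) => /(gl3_commute ia ib) e; apply: ab.
exact: mx3_entry.
Qed.

End MatrixColouring.

(* Found by computer search; the n-th pair gives the over-strand of crossing  *)
(* n + 1.                                                                     *)
Definition colours_9_32 :=
  [:: (id3, id3);
   ([:: [:: 2; 0; 0]; [:: 0; 10; 0]; [:: 0; 0; 32]],
    [:: [:: 36; 0; 0]; [:: 0; 64; 0]; [:: 0; 0; 20]]);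
   ([:: [:: 4; 0; 0]; [:: 0; 29; 0]; [:: 0; 0; 30]],
    [:: [:: 18; 0; 0]; [:: 0; 49; 0]; [:: 0; 0; 45]]);
   ([:: [:: 18; 0; 0]; [:: 0; 49; 0]; [:: 0; 0; 45]],
    [:: [:: 4; 0; 0]; [:: 0; 29; 0]; [:: 0; 0; 30]]);
   ([:: [:: 30; 32; 0]; [:: 20; 13; 0]; [:: 0; 0; 23]],
    [:: [:: 15; 45; 0]; [:: 37; 51; 0]; [:: 0; 0; 34]]);
   ([:: [:: 8; 0; 0]; [:: 0; 6; 0]; [:: 0; 0; 37]],
    [:: [:: 9; 0; 0]; [:: 0; 12; 0]; [:: 0; 0; 48]]);
   ([:: [:: 4; 35; 8]; [:: 13; 41; 12]; [:: 9; 50; 11]],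
    [:: [:: 64; 15; 21]; [:: 36; 43; 56]; [:: 68; 44; 64]]);
   ([:: [:: 38; 13; 43]; [:: 17; 70; 29]; [:: 4; 38; 31]],
    [:: [:: 3; 24; 65]; [:: 15; 12; 55]; [:: 11; 28; 25]]);
   ([:: [:: 49; 10; 39]; [:: 24; 57; 7]; [:: 35; 41; 2]],
    [:: [:: 40; 17; 48]; [:: 55; 11; 25]; [:: 54; 45; 68]])].

Definition colours_9_33 :=
  [:: (id3, id3);
   ([:: [:: 2; 0; 0]; [:: 0; 20; 0]; [:: 0; 0; 40]],
    [:: [:: 21; 0; 0]; [:: 0; 39; 0]; [:: 0; 0; 40]]);
   ([:: [:: 4; 0; 0]; [:: 0; 31; 0]; [:: 0; 0; 1]],
    [:: [:: 31; 0; 0]; [:: 0; 4; 0]; [:: 0; 0; 1]]);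
   ([:: [:: 31; 0; 0]; [:: 0; 4; 0]; [:: 0; 0; 1]],
    [:: [:: 4; 0; 0]; [:: 0; 31; 0]; [:: 0; 0; 1]]);
   ([:: [:: 28; 40; 0]; [:: 7; 3; 0]; [:: 0; 0; 32]],
    [:: [:: 14; 32; 0]; [:: 22; 35; 0]; [:: 0; 0; 9]]);
   ([:: [:: 8; 0; 0]; [:: 0; 5; 0]; [:: 0; 0; 40]],
    [:: [:: 36; 0; 0]; [:: 0; 33; 0]; [:: 0; 0; 40]]);
   ([:: [:: 13; 20; 33]; [:: 24; 12; 20]; [:: 13; 31; 36]],
    [:: [:: 17; 16; 4]; [:: 11; 39; 40]; [:: 14; 21; 4]]);
   ([:: [:: 28; 21; 10]; [:: 17; 29; 16]; [:: 35; 33; 36]],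
    [:: [:: 24; 25; 5]; [:: 30; 2; 9]; [:: 38; 16; 4]]);
   ([:: [:: 19; 16; 1]; [:: 11; 9; 37]; [:: 24; 2; 4]],
    [:: [:: 3; 20; 9]; [:: 24; 11; 5]; [:: 11; 18; 36]])].

Lemma rich_9_32 : rich {'GL_3['Z_71]} code_9_32.
Proof.
(* Letters 1 and 9 belong to crossings 2 and 7. The first matrix is diagonal with distinct entries
   and the second is nonzero at (0, 1), so the products differ there. *)
by apply: (@matrix_rich 71 isT (fun n => nth (id3, id3) colours_9_32 n.-1) _
  (nth (0, true, true) code_9_32 1) (nth (0, true, true) code_9_32 9) 0 1);
  vm_compute.
Qed.

Lemma rich_9_33 : rich {'GL_3['Z_41]} code_9_33.
Proof.
by apply: (@matrix_rich 41 isT (fun n => nth (id3, id3) colours_9_33 n.-1) _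
  (nth (0, true, true) code_9_33 1) (nth (0, true, true) code_9_33 9) 0 1);
  vm_compute.
Qed.

(** * Upper bounds by explicit diagrams *)

Definition is_diagram w : bool := gauss_code w && planar w.

(* The third Reidemeister move on the sides that start at the positions 0, m  *)
(* and n; [slide false] reassembles w.                                        *)
Definition slide (swap : bool) m n w : seq letter :=
  let side k := let s := take 2 (drop k w) in if swap then rev s else s in
  side 0 ++ take (m - 2) (drop 2 w) ++ side m ++
  take (n - m.+2) (drop m.+2 w) ++ side n ++ drop n.+2 w.

Lemma move_slide m n w (l := nth (0, true, true) w) :
  m.+1 < size w -> n.+1 < size w -> 1 < size w -> slide false m n w = w ->
  triangle w (l 0) (l m) (l n) ->
  [|| over (l 0) && over (l 1), over (l m) && over (l m.+1) |
      over (l n) && over (l n.+1)] ->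
  move w (slide true m n w).
Proof.
have side k : k.+1 < size w -> take 2 (drop k w) = [:: l k; l k.+1].
  move=> kw; rewrite (drop_nth (0, true, true)) 1?ltnW //.
  by rewrite (drop_nth (0, true, true)) //= take0.
move=> mw nw w2; rewrite /slide !side // => e tri ov.
by rewrite -[w in move w _]e; apply: R3 ov; rewrite e.
Qed.

(** The rotations by [i], [j] and [k] place the base point for the second move, for the third move
    and for the final count. *)
Lemma achieved_detour K v i j k m n c (w := rot j v)
    (l := nth (0, true, true) w) :
  is_diagram (rot i (code K)) -> is_diagram v -> is_diagram w ->
  is_diagram (slide true m n w) -> is_diagram (rot k (slide true m n w)) ->
  move v (rot i (code K)) ->
  [&& m.+1 < size w, n.+1 < size w, 1 < size w, slide false m n w == w,
      triangle w (l 0) (l m) (l n) &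
      [|| over (l 0) && over (l 1), over (l m) && over (l m.+1) |
          over (l n) && over (l n.+1)]] ->
  size (roller_coaster_changes (rot k (slide true m n w))) = c ->
  achieved K c.
Proof.
move=> di dv dw ds dk mv /and5P[mw nw w2 /eqP ew /andP[tri ov]] <-.
exists (Diagram dk) => //.
have step u u' (du : is_diagram u) (du' : is_diagram u') : move u u' ->
  same_knot (Diagram du) (Diagram du') by move=> mu; apply: rst_step.
have s1 : same_knot K (Diagram di) by apply/rst_step/Base_point.
have s2 : same_knot (Diagram di) (Diagram dv) by apply/rst_sym/step.
have s3 : same_knot (Diagram dv) (Diagram dw) by apply/step/Base_point.
have s4 : same_knot (Diagram dw) (Diagram ds) by apply/step/move_slide.
have s5 : same_knot (Diagram ds) (Diagram dk) by apply/step/Base_point.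
by do 4![apply: rst_trans; last eassumption].
Qed.

Lemma ascending_number_le K n : achieved K n -> ascending_number K <= n.
Proof.
move=> Kn; rewrite /ascending_number; case: ex_minnP => m _; apply.
exact/boolp.asboolP.
Qed.

(* Crossings 10 and 11 are created by a second Reidemeister move.             *)
Definition detour_9_32 : seq letter :=
  let w := rot 1 code_9_32 in
  let x := (10, false, false) in let y := (11, false, true) in
  [:: x; y] ++ take 14 w ++ [:: opp y; opp x] ++ drop 14 w.

Definition detour_9_33 : seq letter :=
  let w := rot 1 code_9_33 in
  let x := (10, false, true) in let y := (11, false, false) in
  [:: x; y] ++ take 13 w ++ [:: opp x; opp y] ++ drop 13 w.

Definition detour_9_40 : seq letter :=
  let w := rot 2 code_9_40 in
  let x := (10, true, false) in let y := (11, true, true) in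
  [:: x; y] ++ take 8 w ++ [:: opp y; opp x] ++ drop 8 w.

Lemma achieved_9_32 : achieved knot_9_32 2.
Proof.
(* The triangle has the crossings 2, 7 and 11; its bottom strand slides under crossing 7. *)
apply: (@achieved_detour _ detour_9_32 1 1 9 8 14); try by vm_compute.
by rewrite -[rot 1 _](cat_take_drop 14); apply: R2_antiparallel.
Qed.

Lemma achieved_9_33 : achieved knot_9_33 2.
Proof.
apply: (@achieved_detour _ detour_9_33 1 1 9 8 15); try by vm_compute.
by rewrite -[rot 1 _](cat_take_drop 13); apply: R2_parallel.
Qed.

Lemma achieved_9_40 : achieved knot_9_40 3.
Proof.
(* Here the new strand is the top side of the triangle 3, 8, 11 and slides over crossing 8. *)
apply: (@achieved_detour _ detour_9_40 2 1 16 8 15); try by vm_compute.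
by rewrite -[rot 2 _](cat_take_drop 8); apply: R2_antiparallel.
Qed.

Lemma ascending_number2 (G : groupType) K :
  rich G (code K) -> achieved K 2 -> ascending_number K = 2.
Proof.
move=> /rich_ascending lo /ascending_number_le hi.
by apply/eqP; rewrite eqn_leq hi lo.
Qed.

Theorem proposition9 :
  (ascending_number knot_9_32 = 2 /\ ascending_number knot_9_33 = 2) /\
  ascending_number knot_9_40 <= 3.
Proof.
split; last exact (@ascending_number_le knot_9_40 3 achieved_9_40).
split; first exact (@ascending_number2 _ knot_9_32 rich_9_32 achieved_9_32).
exact (@ascending_number2 _ knot_9_33 rich_9_33 achieved_9_33).
Qed.
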